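(* Fix an integer $m\ge0$. Consider the compatibility condition on a function $f$ on $\mathbb{R}_+$: $$\text{(A)}\quad \partial_x^{4j}f(0)=0\ (j=0,\dots,m),\qquad \partial_x^{4j+1}f(0)=0\ (j=0,\dots,m-1),$$ and the additional condition $$\text{(B)}\quad \partial_x^{4m+1}f(0)=0 .$$ There exists $C>0$, independent of $t>0$, such that the following hold for all $t>0$: (i) If $f\in C^{4m+1}(\mathbb{R}_+)\cap W^{4m+1,1}(\mathbb{R}_+)$ and (A) holds, then $$\|\partial_x^{4m+1}S(t)f\|_{C(\mathbb{R}_+)}\le C\|f\|_{C^{4m+1}(\mathbb{R}_+)},\qquad \|\partial_x^{4m+1}S(t)f\|_{L^1(\mathbb{R}_+)}\le C\|f\|_{W^{4m+1,1}(\mathbb{R}_+)}.$$ (ii) If $f\in C^{4m+2}(\mathbb{R}_+)\cap W^{4m+2,1}(\mathbb{R}_+)$ and (A) and (B) hold, then $$\|\partial_x^{4m+2}S(t)f\|_{C(\mathbb{R}_+)}\le C\|f\|_{C^{4m+2}(\mathbb{R}_+)},\qquad \|\partial_x^{4m+2}S(t)f\|_{L^1(\mathbb{R}_+)}\le C\|f\|_{W^{4m+2,1}(\mathbb{R}_+)}.$$ (iii) If $f\in C^{4m+3}(\mathbb{R}_+)\cap W^{4m+3,1}(\mathbb{R}_+)$ and (A) and (B) hold, then $$\|\partial_x^{4m+3}S(t)f\|_{C(\mathbb{R}_+)}\le C\|f\|_{C^{4m+3}(\mathbb{R}_+)},\qquad \|\partial_x^{4m+3}S(t)f\|_{L^1(\mathbb{R}_+)}\le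 C\|f\|_{W^{4m+3,1}(\mathbb{R}_+)}.$$ (iv) If $f\in C^{4m+4}(\mathbb{R}_+)\cap W^{4m+4,1}(\mathbb{R}_+)$ and (A) and (B) hold, then $$\|\partial_x^{4m+4}S(t)f\|_{C(\mathbb{R}_+)}\le C\|f\|_{C^{4m+4}(\mathbb{R}_+)},\qquad \|\partial_x^{4m+4}S(t)f\|_{L^1(\mathbb{R}_+)}\le C\|f\|_{W^{4m+4,1}(\mathbb{R}_+)}.$$
   Context: $\mathbb{R}_+$ denotes the half-line $(0,\infty)$; values of functions and derivatives at $0$ are boundary values (limits as $x\to0^+$). $C^k(\mathbb{R}_+)$ is the space of functions whose derivatives up to order $k$ are continuous and bounded on $\mathbb{R}_+$, with norm the sum of the sup norms of these derivatives; $C(\mathbb{R}_+)=C^0(\mathbb{R}_+)$. $W^{k,1}(\mathbb{R}_+)$ is the Sobolev space of $f\in L^1(\mathbb{R}_+)$ with $\partial_x^l f\in L^1(\mathbb{R}_+)$ for all $0\le l\le k$, with norm $\sum_{l=0}^k\|\partial_x^l f\|_{L^1}$. For $r\ge0$ let $\Phi(r):=e^{-r}+\sin r-\cos r$, and for $t>0$, $x,y\ge0$ let $$K(t,x,y):=\frac1\pi\int_0^\infty e^{-k^4t}\,\Phi(kx)\,\Phi(ky)\,dk .$$ For $t>0$, $x>0$ define $(S(t)f)(x):=\int_0^\infty K(t,x,y)f(y)\,dy$. *)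

(* Defs.v *)
From HB Require Import structures.
From mathcomp Require Import all_boot all_order all_algebra.
From mathcomp Require Import all_classical all_reals all_analysis.

Set Implicit Arguments.
Unset Strict Implicit.
Unset Printing Implicit Defensive.

Import Order.TTheory GRing.Theory Num.Theory.
Import numFieldNormedType.Exports.

Local Open Scope ring_scope.
Local Open Scope classical_set_scope.

(* A function on the open half-line is represented by a total function R -> R
   whose values outside `]0, +oo[ are irrelevant: every definition below only
   looks at points x > 0 (differentiation at such x is local). *)

Section HalfLine.
Context {R : realType}.
Implicit Types (f g : R -> R) (k l m n : nat) (t x y : R).

Definition halfline : set R := `]0, +oo[.

(* `f^`(l)` is a junk value where f is not l times differentiable, so
   existence of the derivatives is stated explicitly. *)
Definition Cdiff k f : Prop :=
  (forall l x, (l < k)%N -> 0 < x -> derivable f^`(l) x 1) /\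
  (forall l x, (l <= k)%N -> 0 < x -> {for x, continuous f^`(l)}).

Definition Ck k f : Prop :=
  Cdiff k f /\
  (forall l, (l <= k)%N -> exists M : R, forall x, 0 < x -> `|f^`(l) x| <= M).

Definition L1 f : Prop :=
  (@lebesgue_measure R).-integrable halfline (EFin \o f).

(* The intersection of C^k with the Sobolev space W^{k,1}: for f in C^k the weak
   derivatives of order <= k are the classical ones. *)
Definition CkWk1 k f : Prop := Ck k f /\ (forall l, (l <= k)%N -> L1 f^`(l)).

Definition normC f : \bar R := ereal_sup [set `|f x|%:E | x in halfline].

Definition normL1 f : \bar R :=
  (\int[@lebesgue_measure R]_(x in halfline) `|f x|%:E)%E.

Definition normCk k f : \bar R := (\sum_(l < k.+1) normC f^`(l))%E.

(* The W^{k,1} norm, for f in CkWk1 k. *)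
Definition normWk1 k f : \bar R := (\sum_(l < k.+1) normL1 f^`(l))%E.

Definition Phi (r : R) : R := expR (- r) + sin r - cos r.

Definition K t x y : R :=
  pi^-1 * \int[@lebesgue_measure R]_(k in halfline)
            (expR (- (k ^+ 4 * t)) * Phi (k * x) * Phi (k * y)).

Definition Sop t f : R -> R :=
  fun x => \int[@lebesgue_measure R]_(y in halfline) (K t x y * f y).

(* The boundary value of the n-th derivative at 0 is a limit from the right. *)
Definition vanishes_at0 n f : Prop := f^`(n) x @[x --> (0 : R)^'+] --> (0 : R).

Definition condA m f : Prop :=
  (forall j, (j <= m)%N -> vanishes_at0 (4 * j) f) /\
  (forall j, (j < m)%N -> vanishes_at0 (4 * j + 1) f).

Definition condB m f : Prop := vanishes_at0 (4 * m + 1) f.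

(* The norm bounds presuppose that the n-th derivative of Sop t f exists and lies
   in C(R_+) and in L^1(R_+); this is part of the assertion. *)
Definition estimates (C : R) t n f : Prop :=
  [/\ Cdiff n (Sop t f),
      Ck 0 (Sop t f)^`(n) /\ (normC (Sop t f)^`(n) <= C%:E * normCk n f)%E &
      L1 (Sop t f)^`(n) /\ (normL1 (Sop t f)^`(n) <= C%:E * normWk1 n f)%E].

End HalfLine.

(* Main.v *)
Require Import Defs.
From HB Require Import structures.
From mathcomp Require Import all_boot all_order all_algebra.
From mathcomp Require Import all_classical all_reals all_analysis.
From mathcomp Require Import measurable_realfun ring lra zify.
Import Order.TTheory GRing.Theory Num.Theory.
Import numFieldNormedType.Exports.
Local Open Scope classical_set_scope.
Local Open Scope ring_scope.

(** On the spectral side, the evolution is the multiplication by e^(-k^4 t).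
Write Phi_n for the n-th derivative of Phi, which is 4-periodic in n, and
F(k) for the integral of Phi(ky) f(y) over y > 0. Then
  d_x^n S(t)f(x) = (1/pi) int_0^oo e^(-k^4 t) k^n Phi_n(kx) F(k) dk
([derive1n_Sop]). As 3n = -n mod 4, the function Phi_(3n) is an n-fold
primitive of Phi, and n integrations by parts turn k^n F(k) into
(-1)^n int_0^oo Phi_(3n)(ky) f^(n)(y) dy ([Phi_transform_derive1n]). The
boundary term of the step from l to l + 1 is a multiple of
Phi_(3l+3)(0) f^(l)(0). As Phi_j(0) = 0 for j = 0, 1 mod 4, it matters only
for l = 0, 1 mod 4, and these are the derivatives that (A) and (B) make
vanish at 0. By Fubini's theorem,
  d_x^n S(t)f(x) = ((-1)^n/pi) int_0^oo kernel(x, y) f^(n)(y) dy,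
  kernel(x, y) = int_0^oo e^(-k^4 t) Phi_n(kx) Phi_(3n)(ky) dk
([evolution_kernel]).

Both estimates are then instances of Schur's test ([young_sup], [young_L1]),
provided that the kernel is at most C tau / (tau^2 + (x - y)^2), where
tau = t^(1/4): this majorant is integrable in x and in y, with an integral
that does not depend on tau. That bound ([normr_kernel_poisson]) is the heart
of the matter. The product Phi_n(kx) Phi_(3n)(ky) is a sum of five damped
oscillations Re(c e^(-kz)), with z = i(x - y), i(x + y), x + y, x + iy and
y + ix. Two integrations by parts in k against e^(-k^4 t) give for each of
them a boundary term Re(c/z) and a remainder of order tau / |z|^2
([integral_gauss_wave]). The boundary terms decay like 1/(x + y), which is not
integrable, but their sum is zero. As |z| >= |x - y| in all five cases, the
kernel decays quadratically away from the diagonal, and near the diagonal the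
trivial bound of order 1/tau is enough. *)

Section HalfLineEvolution.
Set Implicit Arguments.
Unset Strict Implicit.
Unset Printing Implicit Defensive.
Context {R : realType}.
Implicit Types (f g h p q : R -> R) (a b c k s t x y z tau : R) (i j l m n : nat).
Local Notation mu := (@lebesgue_measure R).
Local Notation H := (@halfline R).

(** * The derivatives of Phi *)

(** Spelling out one period makes [phi n.+4] and [phi n] convertible, so that
[phi n.+3] is a primitive of [phi n]. *)
Fixpoint phi n : R -> R :=
  match n with
  | 0 => fun r => expR (- r) + sin r - cos r
  | 1 => fun r => - expR (- r) + cos r + sin r
  | 2 => fun r => expR (- r) - sin r + cos r
  | 3 => fun r => - expR (- r) - cos r - sin r
  | n'.+4 => phi n'
  end.

Lemma phi4D n m : phi (4 * m + n) = phi n.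
Proof. by elim: m => [|m <-]; rewrite ?mul0n ?add0n // mulnS -addnA. Qed.

Lemma phi_modn n : phi n = phi (n %% 4).
Proof. by rewrite {1}(divn_eq n 4) mulnC phi4D. Qed.

Lemma is_derive_expRN x : is_derive x 1 (fun r : R => expR (- r)) (- expR (- x)).
Proof.
have -> : - expR (- x) = expR (- x) * (-1) by rewrite mulrN1.
exact: is_derive1_comp.
Qed.

Lemma is_derive_scale c x : is_derive x 1 (fun x => c * x) c.
Proof. by apply: is_derive_eq; rewrite -![_ *: _]/(_ * _) ?mulr1 ?mulr0 ?addr0 ?add0r. Qed.

Lemma is_derive_continuous f x d : is_derive x 1 f d -> {for x, continuous f}.
Proof.
by move=> df; apply: differentiable_continuous; apply/derivable1_diffP; case: df.
Qed.

Lemma is_derive_phi n x : is_derive x 1 (phi n) (phi n.+1 x).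
Proof.
have := @is_derive_expRN x => ?.
rewrite phi_modn [phi n.+1]phi_modn -[in n.+1]addn1 -modnDml addn1.
have : (n %% 4 < 4)%N by rewrite ltn_mod.
move: (n %% 4)%N; do 4?[case] => //= _.
all: by apply: is_derive_eq; rewrite ?opprK.
Qed.

Lemma continuous_phi n : continuous (phi n).
Proof. by move=> x; exact: is_derive_continuous (is_derive_phi n x). Qed.

Lemma is_derive_phi_scale n k x :
  is_derive x 1 (fun x => phi n (k * x)) (phi n.+1 (k * x) * k).
Proof.
exact: (@is_derive1_comp R (phi n) (fun x => k * x) x _ _
  (is_derive_phi n _) (is_derive_scale k x)).
Qed.

Lemma normr_phi n x : 0 <= x -> `|phi n x| <= 3.
Proof.
move=> x0; rewrite phi_modn.
have e0 : 0 <= expR (- x) <= 1 by rewrite expR_ge0 expR_le1 oppr_le0.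
have := sin_geN1 x; have := sin_le1 x; have := cos_geN1 x; have := cos_le1 x.
have : (n %% 4 < 4)%N by rewrite ltn_mod.
move: (n %% 4)%N => {}n n4 c1 c2 s1 s2; rewrite ler_norml.
by case: n n4 => [|[|[|[|//]]]] /= _; lra.
Qed.

(** * Calculus on the half-line *)

Lemma halflineE x : H x = (0 < x) :> Prop.
Proof. by rewrite /halfline /= in_itv /= andbT. Qed.

Lemma measurable_halfline : measurable H.
Proof. exact: measurable_itv. Qed.
#[local] Hint Resolve measurable_halfline : core.

Lemma open_halfline : open H.
Proof. exact: interval_open. Qed.

Lemma continuous_measurable_halfline f :
  (forall x, 0 < x -> {for x, continuous f}) -> measurable_fun H f.
Proof.
move=> cf; apply: open_continuous_measurable_fun; first exact: open_halfline.
by move=> x; rewrite inE halflineE => /cf.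
Qed.

(** An integrable function need not tend to 0 at infinity, but it cannot stay
away from 0. This is enough to choose right endpoints along which a boundary
term at infinity disappears. *)
Lemma L1_small_far h a e : L1 h -> 0 < a -> 0 < e -> exists2 x, a < x & `|h x| <= e.
Proof.
move=> ih a0 e0; apply: contrapT => nex.
have hgt x : a < x -> e < `|h x|.
  by move=> ax; rewrite ltNge; apply/negP => hx; apply: nex; exists x.
have /integrableP[mh] := ih; apply/negP; rewrite -leNgt.
have aH : `]a, +oo[ `<=` H.
  by move=> x; rewrite halflineE /= in_itv /= andbT; exact: lt_trans.
have maoo : measurable (`]a, +oo[ : set R) by exact: measurable_itv.
have mh1 : measurable_fun H (fun x => `|(EFin \o h) x|%E) by exact: measurableT_comp.
apply: le_trans (ge0_subset_integral mu maoo _ mh1 _ aH); [|by []|by []].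
apply: (@le_trans _ _ (\int[mu]_(x in `]a, +oo[) (cst e%:E x))%E).
  by rewrite integral_cst //= lebesgue_measure_itv /= ltry gt0_muley // lte_fin.
apply: ge0_le_integral => //.
- by move=> x _; rewrite lee_fin ltW.
- exact: measurable_funS mh1.
- by move=> x; rewrite /= in_itv /= andbT lee_fin => /hgt/ltW.
Qed.

(** Exhaust the half-line by segments `[1/(n+1), b n] whose right endpoints make
[h (b n)] small. On each of them the usual fundamental theorem of calculus
applies, and dominated convergence gives the limit. *)
Lemma integral_derive_halfline h h' c :
  (forall x, 0 < x -> is_derive x 1 h (h' x)) ->
  (forall x, 0 < x -> {for x, continuous h'}) ->
  h x @[x --> 0^'+] --> c -> L1 h -> L1 h' ->
  \int[mu]_(x in H) h' x = - c.
Proof.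
move=> dh ch' h0 ih ih'.
have ch x : 0 < x -> {for x, continuous h}.
  by move=> x0; exact: is_derive_continuous (dh x x0).
have /choice[b bP] n : exists b, n.+1%:R < b /\ `|h b| <= n.+1%:R^-1.
  have := @L1_small_far h n.+1%:R n.+1%:R^-1 ih.
  by rewrite invr_gt0 ltr0n => /(_ isT isT)[b ? ?]; exists b.
pose a n : R := n.+1%:R^-1.
have a0 n : 0 < a n by rewrite invr_gt0 ltr0n.
have ab n : a n < b n.
  case: (bP n) => + _; apply: le_lt_trans.
  by apply: (@le_trans _ _ 1); rewrite ?ler1n // invf_le1 ?ltr0n ?ler1n.
have cvga : a n @[n --> \oo] --> 0 by exact: cvg_harmonic.
have cvgb : h (b n) @[n --> \oo] --> 0.
  apply/norm_cvg0P; apply: (squeeze_cvgr _ (cvg_cst 0) cvga).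
  by apply: nearW => n; rewrite normr_ge0; case: (bP n).
have cvgha : h (a n) @[n --> \oo] --> c.
  by move/cvg_at_rightP : h0; apply; split.
pose f_ n := (EFin \o h') \_ `[a n, b n].
have abH n : `[a n, b n] `<=` H.
  by move=> x; rewrite halflineE /= in_itv /= => /andP[+ _]; exact: lt_le_trans.
have intf n : (\int[mu]_(x in H) f_ n x = (h (b n) - h (a n))%:E)%E.
  rewrite /f_ -integral_mkcondr setIidr //.
  rewrite (@continuous_FTC2 _ h' h) ?EFinB //.
  - by apply: continuous_in_subspaceT => x; rewrite inE => /abH; rewrite halflineE => /ch'.
  - split.
    + by move=> x /subset_itv_oo_cc/abH; rewrite halflineE => /dh[].
    + exact/cvg_at_right_filter/ch.
    + by apply/cvg_at_left_filter/ch; exact: lt_trans (ab n).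
  - move=> x /subset_itv_oo_cc/abH; rewrite halflineE => /dh dx.
    by rewrite derive1E derive_val.
have lim1 : (\int[mu]_(x in H) f_ n x)%E @[n --> \oo] --> (\int[mu]_(x in H) (h' x)%:E)%E.
  apply: (@dominated_cvg _ _ _ mu _ _ f_ (EFin \o h') (fun x => `|(h' x)%:E|%E)) => //.
  - move=> n; apply/measurable_restrict => //.
    by apply: measurable_funS (measurable_int _ ih') => //; exact: subIsetl.
  - move=> x; rewrite halflineE => x0; apply: cvg_near_cst.
    have ax : \forall n \near \oo, a n <= x.
      by apply: (cvgr_le _ cvga).
    near=> n; rewrite /f_ patchE ifT // inE /= in_itv /=; apply/andP; split.
      by near: n.
    apply: (@le_trans _ _ n.+1%:R); last by case: (bP n) => /ltW.
    apply: (@le_trans _ _ n%:R); last by rewrite ler_nat.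
    by near: n; exact: nbhs_infty_ger.
  - exact: integrable_abse ih'.
  - move=> n x _; rewrite /f_ patchE; case: ifP => _ //.
    by rewrite abse0.
have lim2 : (\int[mu]_(x in H) f_ n x)%E @[n --> \oo] --> (- c)%:E.
  rewrite (_ : (fun n => _) = EFin \o (fun n => h (b n) - h (a n))); last first.
    by apply/funext => n; rewrite intf.
  apply: cvg_EFin; first exact: nearW.
  by rewrite -[- c]add0r; exact: cvgB.
by rewrite /Rintegral (cvg_unique _ lim1 lim2).
Unshelve. all: by end_near. Qed.

(** * Poisson kernels as majorants *)

(** For u >= 1 a single term of the exponential series, u^(4(n+1)) / (n+1)!,
already dominates u^(n+2). *)
Lemma monomial_gauss_le n : exists2 c : R, 0 < c &
  forall u : R, 0 <= u -> u ^+ n * expR (- u ^+ 4) <= c / (1 + u ^+ 2).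
Proof.
have f0 : 1 <= (n.+1)`!%:R :> R by rewrite ler1n fact_gt0.
exists (2 * (n.+1)`!%:R); first by rewrite mulr_gt0 // (lt_le_trans ltr01).
move=> u u0; have u2 : 0 < 1 + u ^+ 2 by rewrite ltr_pwDl // sqr_ge0.
rewrite ler_pdivlMr // expRN mulrAC ler_pdivrMr ?expR_gt0 //.
have e1 := @expR_ge1Dxn R (u ^+ 4) n (exprn_ge0 _ u0).
have {e1}e1 : (n.+1)`!%:R + u ^+ (4 * n.+1) <= (n.+1)`!%:R * expR (u ^+ 4).
  apply: (le_trans _ (ler_wpM2l (le_trans ler01 f0) e1)).
  by rewrite mulrDr mulr1 mulrC divfK -?exprM // gt_eqF // (lt_le_trans ltr01).
rewrite -mulrA; apply: (le_trans _ (ler_wpM2l (ler0n R 2) e1)).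
have [u1|/ltW u1] := leP u 1.
  apply: (@le_trans _ _ 2).
    rewrite -[2]mul1r ler_pM // ?exprn_ge0 ?(ltW u2) // ?exprn_ile1 //.
    by rewrite -[2]/(1 + 1) lerD2l expr_le1.
  by rewrite -[leLHS]mulr1 ler_wpM2l // (le_trans f0) // lerDl exprn_ge0.
apply: (@le_trans _ _ (2 * u ^+ (4 * n.+1))); last first.
  by rewrite ler_wpM2l // lerDr (le_trans ler01).
have un : u ^+ n <= u ^+ (4 * n.+1) by rewrite ler_weXn2l //; lia.
have un2 : u ^+ n * u ^+ 2 <= u ^+ (4 * n.+1) by rewrite -exprD ler_weXn2l //; lia.
by rewrite mulrDr mulr1 mulr_natl mulr2n lerD.
Qed.

(** The Poisson kernel of the half-plane, up to the factor [pi]: it has the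
quadratic decay that two integrations by parts yield, and its mass does not
depend on the scale [s]. *)
Definition poisson s z := s / (s ^+ 2 + z ^+ 2).

Lemma poisson_ge0 s z : 0 < s -> 0 <= poisson s z.
Proof. by move=> s0; rewrite divr_ge0 ?addr_ge0 ?sqr_ge0 // ltW. Qed.

Lemma poisson_sym s z : poisson s (- z) = poisson s z.
Proof. by rewrite /poisson sqrrN. Qed.

Lemma continuous_poisson s : 0 < s -> continuous (poisson s).
Proof.
move=> s0 z; apply: cvgM; first exact: cvg_cst.
apply: cvgV; first by rewrite gt_eqF // ltr_pwDl ?sqr_ge0 // exprn_gt0.
by apply: cvgD; [exact: cvg_cst | apply: cvgM; exact: cvg_id].
Qed.

Lemma is_derive_atan_scale s x y : 0 < s ->
  is_derive y 1 (fun y => atan ((y - x) / s)) (poisson s (y - x)).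
Proof.
move=> s0; have d1 : is_derive y 1 (fun y => (y - x) / s) s^-1.
  by apply: is_derive_eq; rewrite scaler0 add0r subr0 -[_ *: _]/(s^-1 * 1) mulr1.
have d2 : is_derive y 1 (atan \o (fun y => (y - x) / s))
   ((1 + ((y - x) / s) ^+ 2)^-1 * s^-1) by exact: is_derive1_comp.
apply: is_derive_eq d2 _.
rewrite /poisson; field; apply/andP; split; rewrite gt_eqF //.
by rewrite ltr_pwDl ?sqr_ge0 // exprn_gt0.
Qed.

Lemma continuous_poissonB s x : 0 < s ->
  continuous (fun y => poisson s (x - y)).
Proof.
move=> s0 y; apply: (@continuous_comp _ _ _ (fun y => x - y) (poisson s)).
  by apply: cvgB; [exact: cvg_cst | exact: cvg_id].
exact: continuous_poisson.
Qed.

(** The primitive [atan ((y - x) / s)] has total variation less than [pi]. *)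
Lemma integral_poisson_le s x : 0 < s ->
  (\int[mu]_(y in H) (poisson s (x - y))%:E <= pi%:E)%E.
Proof.
move=> s0; have cp := @continuous_poissonB s x s0.
have mp : measurable_fun [set: R] (fun y => (poisson s (x - y))%:E).
  by apply/measurable_EFinP; exact: continuous_measurable_fun.
rewrite /halfline integral_itv_obnd_cbnd; last exact: measurable_funS mp.
rewrite (@ge0_continuous_FTC2y _ _ (fun y => atan ((y - x) / s)) 0 (pi / 2)).
- rewrite -EFinB lee_fin.
  have := @atan_gtNpi2 R ((0 - x) / s); lra.
- by move=> y _; exact: poisson_ge0.
- exact: continuous_subspaceT.
- apply: (cvg_comp _ _ _ (@cvgy_atan R)).
  apply/cvgryPge => A; near=> y.
  rewrite ler_pdivlMr // lerBrDr.
  by near: y; apply: nbhs_pinfty_ge; exact: num_real.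
- by move=> y _; case: (@is_derive_atan_scale s x y s0).
- apply: cvg_at_right_filter.
  exact: is_derive_continuous (@is_derive_atan_scale s x 0 s0).
- move=> y _; have dy := @is_derive_atan_scale s x y s0.
  by rewrite derive1E derive_val -[in RHS]opprB poisson_sym.
Unshelve. all: by end_near. Qed.

Lemma L1_poisson s x : 0 < s -> L1 (fun y => poisson s (x - y)).
Proof.
move=> s0; have mp : measurable_fun H (fun y => poisson s (x - y)).
  by apply: continuous_measurable_halfline => y _; exact: continuous_poissonB.
apply/integrableP; split; first exact/measurable_EFinP.
apply: (@le_lt_trans _ _ (pi : R)%:E); last exact: ltry.
apply: le_trans (@integral_poisson_le s x s0); apply: ge0_le_integral => //.
- by apply: measurableT_comp => //; exact/measurable_EFinP.
- exact/measurable_EFinP.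
- by move=> y _; rewrite /= lee_fin ger0_norm // poisson_ge0.
Qed.

Lemma L1_le f g : measurable_fun H f -> (forall x, 0 < x -> `|f x| <= g x) ->
  L1 g -> L1 f.
Proof.
move=> mf fg; apply: le_integrable => //; first exact/measurable_EFinP.
move=> x; rewrite halflineE /= lee_fin => /fg h.
by rewrite (le_trans h) // ler_norm.
Qed.

Lemma L1_norm f : L1 f -> L1 (fun x => `|f x|).
Proof. exact: integrable_norm. Qed.

Lemma L1Zl c f : L1 f -> L1 (fun x => c * f x).
Proof.
move=> f1; have := @integrableZl _ _ _ mu _ measurable_halfline c (EFin \o f) f1.
by apply: eq_integrable.
Qed.

Lemma L1D f g : L1 f -> L1 g -> L1 (fun x => f x + g x).
Proof.
move=> f1 g1; have := @integrableD _ _ _ mu _ measurable_halfline _ _ f1 g1.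
by apply: eq_integrable.
Qed.

Lemma L1B f g : L1 f -> L1 g -> L1 (fun x => f x - g x).
Proof.
move=> f1 g1; have := @integrableB _ _ _ mu _ measurable_halfline _ _ f1 g1.
by apply: eq_integrable.
Qed.

Lemma integral_halflineD f g : L1 f -> L1 g ->
  \int[mu]_(x in H) (f x + g x) = \int[mu]_(x in H) f x + \int[mu]_(x in H) g x.
Proof. by move=> f1 g1; exact: RintegralD. Qed.

(** The majorant is [A / tau] times the Poisson kernel of scale [1 / tau]
centred at 0. *)
Lemma dominated_by_poisson f tau (A : R) : 0 < tau -> 0 <= A ->
  measurable_fun H f -> (forall k, 0 < k -> `|f k| <= A / (1 + (tau * k) ^+ 2)) ->
  L1 f /\ \int[mu]_(k in H) `|f k| <= A * pi / tau.
Proof.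
move=> tau0 A0 mf fA; have t0 : 0 < tau^-1 by rewrite invr_gt0.
have eqp k : A / (1 + (tau * k) ^+ 2) = A / tau * poisson tau^-1 (0 - k).
  have k2 : 1 + (tau * k) ^+ 2 != 0 by rewrite gt_eqF // ltr_pwDl // sqr_ge0.
  rewrite /poisson; field.
  by rewrite mulNr sqrrN mulrC gt_eqF.
have ip := @L1Zl (A / tau) _ (@L1_poisson tau^-1 0 t0).
have {}fA k : 0 < k -> `|f k| <= A / tau * poisson tau^-1 (0 - k).
  by move=> k0; rewrite -eqp fA.
have f1 : L1 f by apply: L1_le ip.
split=> //.
apply: (@le_trans _ _ (\int[mu]_(k in H) (A / tau * poisson tau^-1 (0 - k)))).
  by apply: le_Rintegral => //; [exact: L1_norm | move=> k; rewrite halflineE => /fA].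
rewrite RintegralZl //; last exact: L1_poisson.
rewrite [leRHS]mulrAC ler_wpM2l ?divr_ge0 ?(ltW tau0) //.
have := @integral_poisson_le tau^-1 0 t0; rewrite /Rintegral => le_pi.
rewrite -lee_fin fineK //; apply: integrable_fin_num => //.
exact: L1_poisson.
Qed.

(** * The factor exp(-k^4 t) *)

(** For [t = tau ^+ 4] this is the factor e^(-k^4 t) of the kernel [K]; the
length scale [tau] makes the estimates homogeneous. *)
Definition gauss tau k := expR (- (tau * k) ^+ 4).

Definition gauss1 tau k := - (4 * tau * (tau * k) ^+ 3) * gauss tau k.
Definition gauss2 tau k :=
  tau ^+ 2 * (16 * (tau * k) ^+ 6 - 12 * (tau * k) ^+ 2) * gauss tau k.

Lemma is_derive_gauss tau k : is_derive k 1 (gauss tau) (gauss1 tau k).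
Proof.
have d1 : is_derive k 1 (fun k => - (tau * k) ^+ 4) (- (4 * tau * (tau * k) ^+ 3)).
  apply: is_derive_eq; rewrite -![_ *: _]/(_ * _); ring.
have d2 := @is_derive1_comp R expR (fun k => - (tau * k) ^+ 4) k _ _ (is_derive_expR _) d1.
by apply: is_derive_eq d2 _; rewrite mulrC.
Qed.

Lemma is_derive_gauss1 tau k : is_derive k 1 (gauss1 tau) (gauss2 tau k).
Proof.
have := is_derive_gauss tau k => ?.
apply: is_derive_eq; rewrite /gauss2 /gauss1 -![_ *: _]/(_ * _); ring.
Qed.

Lemma continuous_gauss tau : continuous (gauss tau).
Proof. by move=> k; exact: is_derive_continuous (is_derive_gauss tau k). Qed.

Lemma continuous_gauss2 tau : continuous (gauss2 tau).
Proof.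
move=> k; have := is_derive_gauss tau k => ?.
by apply: differentiable_continuous; apply/derivable1_diffP; exact: ex_derive.
Qed.

Lemma gauss_ge0 tau k : 0 <= gauss tau k. Proof. exact: expR_ge0. Qed.

Lemma monomial_gauss_tau n tau : 0 < tau ->
  exists2 c : R, 0 < c & forall k, 0 <= k -> k ^+ n * gauss tau k <= c / (1 + (tau * k) ^+ 2).
Proof.
move=> tau0; have [c c0 hc] := @monomial_gauss_le n.
exists (c / tau ^+ n); first by rewrite divr_gt0 // exprn_gt0.
move=> k k0; rewrite mulrAC ler_pdivlMr ?exprn_gt0 // mulrAC -exprMn [k * _]mulrC.
by apply: hc; rewrite mulr_ge0 // ltW.
Qed.

Lemma L1_monomial_gauss n tau : 0 < tau -> L1 (fun k => k ^+ n * gauss tau k).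
Proof.
move=> tau0; have [c c0 hc] := monomial_gauss_tau n tau0.
have mf : measurable_fun H (fun k => k ^+ n * gauss tau k).
  apply: continuous_measurable_halfline => k _; apply: cvgM.
    by apply: exprn_continuous.
  exact: continuous_gauss.
have [k k0|//] := @dominated_by_poisson _ tau c tau0 (ltW c0) mf.
rewrite ger0_norm; first by apply: hc; exact: ltW.
by rewrite mulr_ge0 ?gauss_ge0 // exprn_ge0 // ltW.
Qed.

Lemma integral_gauss_le : exists2 c : R, 0 < c &
  forall tau, 0 < tau -> \int[mu]_(k in H) gauss tau k <= c / tau.
Proof.
have [c c0 hc] := @monomial_gauss_le 0.
exists (c * pi); first by rewrite mulr_gt0 ?pi_gt0.
move=> tau tau0.
have mg : measurable_fun H (gauss tau).
  by apply: continuous_measurable_halfline => k _; exact: continuous_gauss.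
have [|_] := @dominated_by_poisson _ tau c tau0 (ltW c0) mg.
  move=> k k0; rewrite ger0_norm ?gauss_ge0 //.
  by have := hc (tau * k); rewrite expr0 mul1r; apply; rewrite mulr_ge0 // ltW.
by under eq_Rintegral do rewrite ger0_norm ?gauss_ge0 //.
Qed.

(** [gauss tau] has width [1 / tau] and each derivative costs a factor [tau].
The resulting powers of [tau], here and in [integral_gauss_le], are those
that combine into a Poisson kernel of scale [tau]. *)
Lemma integral_gauss2_le : exists2 c : R, 0 < c &
  forall tau, 0 < tau -> L1 (gauss2 tau) /\ \int[mu]_(k in H) `|gauss2 tau k| <= c * tau.
Proof.
have [c6 c60 h6] := @monomial_gauss_le 6.
have [c2 c20 h2] := @monomial_gauss_le 2.
exists ((16 * c6 + 12 * c2) * pi); first by rewrite mulr_gt0 ?pi_gt0 // addr_gt0 ?mulr_gt0.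
move=> tau tau0.
have mg : measurable_fun H (gauss2 tau).
  by apply: continuous_measurable_halfline => k _; exact: continuous_gauss2.
have A0 : 0 <= tau ^+ 2 * (16 * c6 + 12 * c2).
  by rewrite mulr_ge0 ?sqr_ge0 // addr_ge0 // mulr_ge0 // ltW.
have [|? le] := @dominated_by_poisson _ tau _ tau0 A0 mg.
  move=> k k0; have u0 : 0 <= tau * k by rewrite mulr_ge0 // ltW.
  rewrite /gauss2 -[X in `|X|]mulrA -[leRHS]mulrA normrM (ger0_norm (sqr_ge0 tau)).
  rewrite ler_wpM2l ?sqr_ge0 //.
  have := h6 _ u0; have := h2 _ u0; rewrite /gauss.
  move: (tau * k) u0 => u u0; set e := expR _; set w := _^-1 => b2 b6.
  have e0 : 0 <= e by exact: expR_ge0.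
  have u6 : 0 <= u ^+ 6 * e by rewrite mulr_ge0 ?exprn_ge0.
  have u2 : 0 <= u ^+ 2 * e by rewrite mulr_ge0 ?exprn_ge0.
  rewrite mulrBl mulrDl -!mulrA.
  rewrite ler_norml; lra.
split=> //; apply: le_trans le _.
by rewrite le_eqVlt; apply/orP; left; apply/eqP; field; rewrite gt_eqF.
Qed.

(** * Damped oscillations against exp(-k^4 t) *)

(** The real part of (A + iB) e^(-k(x + iy)): differentiation in k multiplies
A + iB by -(x + iy). *)
Definition wave x y (A B : R) k := expR (- (x * k)) * (A * cos (y * k) + B * sin (y * k)).

Lemma is_derive_wave x y (A B : R) k :
  is_derive k 1 (wave x y A B) (wave x y (y * B - x * A) (- x * B - y * A) k).
Proof.
have d0 c := is_derive_scale c k.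
have d1 : is_derive k 1 (fun k => - (x * k)) (- x) by exact: is_deriveN.
have e := @is_derive1_comp R expR (fun k => - (x * k)) k _ _ (is_derive_expR _) d1.
have c := @is_derive1_comp R cos (fun k => y * k) k _ _ (is_derive_cos _) (d0 y).
have s := @is_derive1_comp R sin (fun k => y * k) k _ _ (is_derive_sin _) (d0 y).
have {}e : is_derive k 1 (fun k => expR (- (x * k))) _ := e.
have {}c : is_derive k 1 (fun k => cos (y * k)) _ := c.
have {}s : is_derive k 1 (fun k => sin (y * k)) _ := s.
apply: is_derive_eq; rewrite /wave -![_ *: _]/(_ * _); ring.
Qed.

Lemma continuous_wave x y (A B : R) : continuous (wave x y A B).
Proof. by move=> k; exact: is_derive_continuous (is_derive_wave x y A B k). Qed.

Lemma normr_wave x y (A B : R) k : 0 <= x -> 0 <= k -> `|wave x y A B k| <= `|A| + `|B|.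
Proof.
move=> x0 k0; rewrite normrM -[leRHS]mul1r ler_pM //.
  by rewrite ger0_norm ?expR_ge0 // expR_le1 oppr_le0 mulr_ge0.
rewrite (le_trans (ler_normD _ _)) // lerD // normrM ler_piMr //.
  by rewrite ler_norml cos_geN1 cos_le1.
by rewrite ler_norml sin_geN1 sin_le1.
Qed.

Lemma L1_monomial_gaussM n tau q (B : R) : 0 < tau ->
  (forall x, 0 < x -> {for x, continuous q}) -> (forall x, 0 < x -> `|q x| <= B) ->
  L1 (fun k => k ^+ n * gauss tau k * q k).
Proof.
move=> tau0 cq qB.
have ig := L1Zl B (@L1_monomial_gauss n tau tau0).
apply: L1_le ig.
  apply: continuous_measurable_halfline => k k0; apply: cvgM; last exact: cq.
  by apply: cvgM; [exact: exprn_continuous | exact: continuous_gauss].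
move=> k k0; have kn : 0 <= k ^+ n * gauss tau k.
  by rewrite mulr_ge0 ?gauss_ge0 ?exprn_ge0 // ltW.
by rewrite normrM ger0_norm // mulrC ler_wpM2r // qB.
Qed.

Lemma L1_gaussM tau q (B : R) : 0 < tau ->
  (forall x, 0 < x -> {for x, continuous q}) -> (forall x, 0 < x -> `|q x| <= B) ->
  L1 (fun k => gauss tau k * q k).
Proof.
move=> tau0 cq qB; have := L1_monomial_gaussM 0 tau0 cq qB.
by under eq_fun do rewrite expr0 mul1r.
Qed.

(** Two integrations by parts in k. The first one produces the boundary value
(xA + yB) / (x^2 + y^2) = Re((A + iB) / (x + iy)); the second one produces none,
because the derivative of [gauss tau] vanishes at 0, and it leaves [gauss2 tau]
against a second primitive of the wave, which is of size |x + iy|^(-2). *)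
Lemma integral_gauss_wave tau x y (A B : R) : 0 < tau -> 0 <= x -> 0 < x ^+ 2 + y ^+ 2 ->
  `|\int[mu]_(k in H) (gauss tau k * wave x y A B k) - (x * A + y * B) / (x ^+ 2 + y ^+ 2)|
   <= 2 * (`|A| + `|B|) / (x ^+ 2 + y ^+ 2) * \int[mu]_(k in H) `|gauss2 tau k|.
Proof.
move=> tau0 x0 rho0; set rho := x ^+ 2 + y ^+ 2.
have rhoN0 : rho != 0 by rewrite gt_eqF.
(* A1 + i B1 = - (A + i B) / (x + i y), and A2 + i B2 is derived from it in
   the same way: they are the coefficients of two successive primitives. *)
pose A1 := - (x * A + y * B) / rho; pose B1 := (y * A - x * B) / rho.
pose A2 := - (x * A1 + y * B1) / rho; pose B2 := (y * A1 - x * B1) / rho.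
have dW k : is_derive k 1 (wave x y A1 B1) (wave x y A B k).
  by apply: is_derive_eq (is_derive_wave x y A1 B1 k) _;
    congr (wave _ _ _ _ _); rewrite /A1 /B1 /rho; field.
have dV k : is_derive k 1 (wave x y A2 B2) (wave x y A1 B1 k).
  by apply: is_derive_eq (is_derive_wave x y A2 B2 k) _;
    congr (wave _ _ _ _ _); rewrite /A2 /B2 /rho; field.
have A2E : A2 = ((x ^+ 2 - y ^+ 2) * A + 2 * x * y * B) / rho ^+ 2.
  by rewrite /A2 /A1 /B1; field.
have B2E : B2 = ((x ^+ 2 - y ^+ 2) * B + - (2 * x * y) * A) / rho ^+ 2.
  by rewrite /B2 /A1 /B1; field.
have AB2 : `|A2| + `|B2| <= 2 * (`|A| + `|B|) / rho.
  have d1 : `|x ^+ 2 - y ^+ 2| <= rho.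
    by rewrite ler_norml /rho; have := sqr_ge0 x; have := sqr_ge0 y; lra.
  have d2 : `|2 * x * y| <= rho.
    rewrite ler_norml /rho; have := sqr_ge0 (x - y); have := sqr_ge0 (x + y).
    by rewrite sqrrD sqrrB; lra.
  have aux (u v C D : R) : `|u| <= rho -> `|v| <= rho ->
      `|(u * C + v * D) / rho ^+ 2| <= (`|C| + `|D|) / rho.
    move=> ur vr; rewrite normrM [`|_^-1|]ger0_norm ?invr_ge0 ?exprn_ge0 ?(ltW rho0) //.
    rewrite ler_pdivrMr ?exprn_gt0 //.
    have -> : (`|C| + `|D|) / rho * rho ^+ 2 = rho * `|C| + rho * `|D| by field.
    by rewrite (le_trans (ler_normD _ _)) // lerD // normrM ler_wpM2r.
  have -> : 2 * (`|A| + `|B|) / rho = (`|A| + `|B|) / rho + (`|B| + `|A|) / rho by field.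
  rewrite A2E B2E lerD //; first exact: aux.
  by apply: aux; rewrite ?normrN.
have dg := @is_derive_gauss tau; have dg1 := @is_derive_gauss1 tau.
pose h k := gauss tau k * wave x y A1 B1 k - gauss1 tau k * wave x y A2 B2 k.
pose h' k := gauss tau k * wave x y A B k - gauss2 tau k * wave x y A2 B2 k.
have dh k : is_derive k 1 h (h' k).
  have := dg k; have := dg1 k; have := dW k; have := dV k => ? ? ? ?.
  by apply: is_derive_eq; rewrite /h' -![_ *: _]/(_ * _); ring.
have [c2 _ /(_ _ tau0)[ig2 _]] := @integral_gauss2_le.
have iW (C D : R) : L1 (fun k => gauss tau k * wave x y C D k).
  apply: (@L1_gaussM tau _ (`|C| + `|D|)) => //.
    by move=> k _; exact: continuous_wave.
  by move=> k k0; rewrite normr_wave // ltW.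
have i2 : L1 (fun k => gauss2 tau k * wave x y A2 B2 k).
  apply: L1_le (L1Zl (`|A2| + `|B2|) (L1_norm ig2)).
    apply: continuous_measurable_halfline => k _; apply: cvgM.
      exact: continuous_gauss2.
    exact: continuous_wave.
  by move=> k k0; rewrite normrM mulrC ler_wpM2r // normr_wave // ltW.
have ih' : L1 h' by apply: L1B.
have ch k : {for k, continuous h} := is_derive_continuous (dh k).
have ih : L1 h.
  have i3 : L1 (fun k => 4 * tau ^+ 4 * (k ^+ 3 * gauss tau k * wave x y A2 B2 k)).
    apply/L1Zl/(@L1_monomial_gaussM 3 tau _ (`|A2| + `|B2|)) => //.
      by move=> k _; exact: continuous_wave.
    by move=> k k0; rewrite normr_wave // ltW.
  have := L1D (iW A1 B1) i3; congr (L1 _).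
  by apply/funext => k; rewrite /h /gauss1; ring.
have h0 : h 0 = A1.
  by rewrite /h /gauss1 /gauss /wave !mulr0 expr0n /= oppr0 expR0 cos0 sin0 expr0n /=; ring.
have hcvg : h k @[k --> 0^'+] --> A1.
  by rewrite -h0; apply: cvg_at_right_filter; exact: ch.
have := @integral_derive_halfline h h' A1 (fun k _ => dh k) _ hcvg ih ih'.
have /[swap] /[apply] : forall k, 0 < k -> {for k, continuous h'}.
  move=> k _; apply: cvgB; apply: cvgM;
    [exact: continuous_gauss | exact: continuous_wave
    |exact: continuous_gauss2 | exact: continuous_wave].
rewrite (@RintegralB _ _ _ mu _ _ _ measurable_halfline (iW A B) i2) => eqI.
have -> : \int[mu]_(k in H) (gauss tau k * wave x y A B k) - (x * A + y * B) / rho =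
   \int[mu]_(k in H) (gauss2 tau k * wave x y A2 B2 k).
  apply/eqP; rewrite subr_eq addrC -subr_eq eqI /A1; apply/eqP; field; exact: rhoN0.
apply: (le_trans (@le_normr_Rintegral _ _ _ mu _ _ measurable_halfline i2)).
apply: (@le_trans _ _ (\int[mu]_(k in H) ((2 * (`|A| + `|B|) / rho) * `|gauss2 tau k|))).
  apply: le_Rintegral => //; [exact: L1_norm | exact/L1Zl/L1_norm |].
  move=> k; rewrite halflineE => k0; rewrite normrM mulrC ler_wpM2r //.
  by apply: le_trans AB2; rewrite normr_wave // ltW.
by rewrite RintegralZl //; exact: L1_norm.
Qed.

(** * The kernel acting on the n-th derivative *)

(** Since 3n = -n mod 4, [phi (3 * n)] is an n-fold primitive of [phi 0]: this
kernel is what remains of Phi(kx) Phi(ky) after n derivatives have been moved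
from x to the datum. *)
Definition kernel n tau x y : R :=
  \int[mu]_(k in H) (gauss tau k * (phi n (k * x) * phi (3 * n) (k * y))).

(** Both functions have the same exponential part, with sign al = (-1)^n, and
their oscillating parts agree up to that sign. *)
Lemma phi_pair n : exists al p : R, [/\ al ^+ 2 = 1, p ^+ 2 = 1,
  (forall r, phi n r = al * expR (- r) + p * (sin r - al * cos r)) &
  (forall r, phi (3 * n) r = al * expR (- r) + al * p * (sin r - al * cos r))].
Proof.
rewrite (@phi_modn n) (@phi_modn (3 * n)) -modnMmr.
have : (n %% 4 < 4)%N by rewrite ltn_mod.
case: (n %% 4)%N => [|[|[|[|//]]]] _ /=.
- by exists 1, 1; split=> [||r|r] /=; ring.
- by exists (-1), 1; split=> [||r|r] /=; ring.
- by exists 1, (-1); split=> [||r|r] /=; ring.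
- by exists (-1), (-1); split=> [||r|r] /=; ring.
Qed.

Lemma normr_sqr1 (u : R) : u ^+ 2 = 1 -> `|u| = 1.
Proof.
by move/eqP; rewrite sqrf_eq1 => /orP[] /eqP ->; rewrite ?normrN normr1.
Qed.

(** The waves belong to the complex numbers i(x - y), i(x + y), x + y, x + iy
and y + ix, all of modulus at least |x - y|. *)
Lemma phi_phi_wave n : exists al p : R, [/\ `|al| = 1, `|p| = 1 & forall x y k,
  phi n (k * x) * phi (3 * n) (k * y) =
    wave 0 (x - y) al 0 k + (wave 0 (x + y) 0 (- 1) k + (wave (x + y) 0 1 0 k +
    (wave x y (- (al * p)) p k + wave y x (- p) (al * p) k)))].
Proof.
have [al [p [al1 p1 e1 e2]]] := phi_pair n.
exists al, p; split; [exact: normr_sqr1 | exact: normr_sqr1 | move=> x y k].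
rewrite e1 e2 /wave !mul0r oppr0 expR0 ?sin0 cos0 mulrBl ![(x + y) * k]mulrDl.
rewrite cosB sinD opprD expRD ![k * _]mulrC.
ring: al1 p1.
Qed.

Lemma continuous_phi_scale n c : continuous (fun k => phi n (k * c)).
Proof.
move=> k; apply: (@continuous_comp _ _ _ (fun k => k * c) (phi n)); last exact: continuous_phi.
by apply: cvgM; [exact: cvg_id | exact: cvg_cst].
Qed.

Lemma normr_kernel_le n tau x y : 0 < tau -> 0 < x -> 0 < y ->
  `|kernel n tau x y| <= 9 * \int[mu]_(k in H) gauss tau k.
Proof.
move=> tau0 x0 y0.
have b9 k : 0 < k -> `|phi n (k * x) * phi (3 * n) (k * y)| <= 9.
  move=> k0; have -> : 9 = 3 * 3 :> R by rewrite -natrM.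
  by rewrite normrM ler_pM // normr_phi // mulr_ge0 // ltW.
have ig : L1 (gauss tau).
  by have := @L1_monomial_gauss 0 tau tau0; under eq_fun do rewrite expr0 mul1r.
have iK : L1 (fun k => gauss tau k * (phi n (k * x) * phi (3 * n) (k * y))).
  apply: (L1_gaussM tau0 _ b9) => k k0.
  by apply: cvgM; exact: continuous_phi_scale.
apply: (le_trans (@le_normr_Rintegral _ _ _ mu _ _ measurable_halfline iK)).
rewrite -RintegralZl //; apply: le_Rintegral => //.
- exact: L1_norm.
- exact: L1Zl.
- move=> k; rewrite halflineE => k0; rewrite normrM (ger0_norm (gauss_ge0 _ _)) [leLHS]mulrC.
  by rewrite ler_wpM2r ?gauss_ge0 ?b9.
Qed.

(** By [integral_gauss_wave], each of the five waves contributes a boundary term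
and a remainder. Apart from the first one, which is 0, the boundary terms are
only of order 1 / (x + y), which would not be integrable, but they add up to 0.
The constant is 14 = 2 + 2 + 2 + 4 + 4, twice the sum of the amplitudes. *)
Lemma normr_kernel_far_le n tau x y : 0 < tau -> 0 < x -> 0 < y -> x != y ->
  `|kernel n tau x y| <= 14 / (x - y) ^+ 2 * \int[mu]_(k in H) `|gauss2 tau k|.
Proof.
move=> tau0 x0 y0 xy.
have [al [p [al1 p1 e]]] := phi_phi_wave n.
rewrite /kernel; under eq_Rintegral do rewrite e.
have iW (x' y' A B : R) : 0 <= x' -> L1 (fun k => gauss tau k * wave x' y' A B k).
  move=> x0'; apply: (@L1_gaussM tau _ (`|A| + `|B|)) => //.
    by move=> k _; exact: continuous_wave.
  by move=> k k0; rewrite normr_wave // ltW.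
set M := \int[mu]_(k in H) `|gauss2 tau k|.
have M0 : 0 <= M by apply: Rintegral_ge0.
have s0 : 0 < x + y by exact: addr_gt0.
have d0 : 0 < (x - y) ^+ 2 by rewrite exprn_even_gt0 //= subr_eq0.
have ds : (x - y) ^+ 2 <= (x + y) ^+ 2.
  by rewrite sqrrB sqrrD; have := mulr_gt0 x0 y0; lra.
have dr : (x - y) ^+ 2 <= x ^+ 2 + y ^+ 2.
  by rewrite sqrrB; have := mulr_gt0 x0 y0; lra.
have iWs := (@integral_gauss_wave tau _ _ _ _ tau0).
have := iWs 0 (x - y) al 0; rewrite lexx expr0n add0r => /(_ isT d0).
have := iWs 0 (x + y) 0 (-1); rewrite lexx expr0n add0r => /(_ isT (exprn_gt0 2 s0)).
have := iWs (x + y) 0 1 0; rewrite ltW // expr0n addr0 => /(_ isT (exprn_gt0 2 s0)).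
have r0 : 0 < x ^+ 2 + y ^+ 2 by rewrite addr_gt0 // exprn_gt0.
have := iWs x y (- (al * p)) p; rewrite ltW // => /(_ isT r0).
have := iWs y x (- p) (al * p); rewrite ltW // [y ^+ 2 + _]addrC => /(_ isT r0).
rewrite -/M !normrN !normrM al1 p1 normr0 normr1 !mul1r !mul0r !mulr0 !mulr1 !add0r !addr0.
set I5 := Rintegral _ _ _; set I4 := Rintegral _ _ _; set I3 := Rintegral _ _ _.
set I2 := Rintegral _ _ _; set I1 := Rintegral _ _ _ => h5 h4 h3 h2 h1.
have -> : \int[mu]_(k in H) (gauss tau k * (wave 0 (x - y) al 0 k + (wave 0 (x + y) 0 (- 1) k +
   (wave (x + y) 0 1 0 k + (wave x y (- (al * p)) p k + wave y x (- p) (al * p) k))))) =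
   I1 + (I2 + (I3 + (I4 + I5))).
  under eq_Rintegral do rewrite !mulrDr.
  have x0' := ltW x0; have y0' := ltW y0; have s0' := ltW s0.
  by rewrite !integral_halflineD //; do ?[apply: L1D | apply: iW].
have le14 (I J K N P : R) : `|I + (J + (K + (N + P)))| <= `|I| + `|J| + `|K| + `|N| + `|P|.
  by rewrite -!addrA; do 4 (apply: (le_trans (ler_normD _ _)); rewrite ?lerD2l).
set b2 := _ / _ in h2; set b3 := _ / _ in h3; set b4 := _ / _ in h4; set b5 := _ / _ in h5.
have bsum : b2 + b3 + b4 + b5 = 0.
  by rewrite /b2 /b3 /b4 /b5; field; rewrite (gt_eqF r0) (gt_eqF s0).
have -> : I1 + (I2 + (I3 + (I4 + I5))) =
    I1 - 0 / (x - y) ^+ 2 + (I2 - b2 + (I3 - b3 + (I4 - b4 + (I5 - b5)))).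
  by rewrite mul0r; transitivity (I1 + (I2 + (I3 + (I4 + I5))) - (b2 + b3 + b4 + b5));
    [rewrite bsum subr0 | ring].
apply: le_trans (le14 _ _ _ _ _) _.
have le_d c r : 0 <= c -> (x - y) ^+ 2 <= r -> c / r * M <= c * (M / (x - y) ^+ 2).
  move=> c0 de; rewrite -mulrA ler_wpM2l // mulrC ler_wpM2l // lef_pV2 // posrE.
  exact: lt_le_trans de.
have -> : 14 / (x - y) ^+ 2 * M = 14 * (M / (x - y) ^+ 2) by rewrite mulrAC mulrA.
move/le_trans: h1 => /(_ _ (le_d _ _ _ (lexx _))).
move/le_trans: h2 => /(_ _ (le_d _ _ _ ds)); move/le_trans: h3 => /(_ _ (le_d _ _ _ ds)).
move/le_trans: h4 => /(_ _ (le_d _ _ _ dr)); move/le_trans: h5 => /(_ _ (le_d _ _ _ dr)).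
rewrite !mulr1 !mulr_ge0 ?addr_ge0 // => /(_ isT) h5 /(_ isT) h4.
move=> /(_ isT) h3 /(_ isT) h2 /(_ isT) h1.
lra.
Qed.

(** The bounds of order 1 / tau and tau / (x - y)^2 together say that the kernel
times tau^2 + (x - y)^2 is of order tau. *)
Lemma normr_kernel_poisson : exists2 C : R, 0 < C & forall n tau x y,
  0 < tau -> 0 < x -> 0 < y -> `|kernel n tau x y| <= C * poisson tau (x - y).
Proof.
have [c c0 hc] := @integral_gauss_le.
have [c2 c20 hc2] := @integral_gauss2_le.
exists (9 * c + 14 * c2); first by rewrite addr_gt0 // mulr_gt0.
move=> n tau x y tau0 x0 y0.
have near_bound : `|kernel n tau x y| * tau ^+ 2 <= 9 * c * tau.
  have -> : 9 * c * tau = 9 * (c / tau) * tau ^+ 2 by field; rewrite gt_eqF.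
  rewrite ler_wpM2r ?sqr_ge0 // (le_trans (normr_kernel_le n tau0 x0 y0)) //.
  by rewrite ler_wpM2l // hc.
have far_bound : `|kernel n tau x y| * (x - y) ^+ 2 <= 14 * c2 * tau.
  have [->|xy] := eqVneq x y.
    by rewrite subrr expr0n mulr0 !mulr_ge0 // ltW.
  have d0 : 0 < (x - y) ^+ 2 by rewrite exprn_even_gt0 //= subr_eq0.
  rewrite -ler_pdivlMr // (le_trans (normr_kernel_far_le n tau0 x0 y0 xy)) //.
  have -> : 14 * c2 * tau / (x - y) ^+ 2 = 14 / (x - y) ^+ 2 * (c2 * tau).
    by field; rewrite subr_eq0.
  by rewrite ler_wpM2l ?divr_ge0 ?(ltW d0) //; case: (hc2 _ tau0).
rewrite /poisson mulrA ler_pdivlMr; last by rewrite ltr_pwDl ?sqr_ge0 // exprn_gt0.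
by rewrite mulrDr (mulrDl (9 * c)) lerD.
Qed.

(** * Exchanging the integrations in k and y *)

Lemma L1_setT f : L1 f <-> mu.-integrable setT (EFin \o (f \_ H)).
Proof. by rewrite -restrict_EFin; exact: integrable_mkcond. Qed.

(** The integrand is dominated by the product of two integrable functions of
one variable. *)
Lemma fubini_setT p q (B : R * R -> R) (M : R) :
  mu.-integrable setT (EFin \o p) -> mu.-integrable setT (EFin \o q) ->
  measurable_fun setT B -> (forall z : R * R, `|B z| <= M) ->
  mu.-integrable setT (EFin \o (fun k => p k * \int[mu]_y (B (k, y) * q y))) /\
      \int[mu]_k (p k * \int[mu]_y (B (k, y) * q y)) =
      \int[mu]_y ((\int[mu]_k (p k * B (k, y))) * q y).
Proof.
move=> ip iq mB BM.
have mp : measurable_fun setT p by apply/measurable_EFinP; exact: measurable_int ip.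
have mq : measurable_fun setT q by apply/measurable_EFinP; exact: measurable_int iq.
have M0 : 0 <= M := le_trans (normr_ge0 _) (BM (0, 0)).
pose f (z : R * R) : \bar R := (p z.1 * (B z * q z.2))%:E.
have mf : measurable_fun setT f.
  apply/measurable_EFinP/measurable_funM.
    exact: measurableT_comp mp measurable_fst.
  apply: measurable_funM => //; exact: measurableT_comp mq measurable_snd.
have iBq k : mu.-integrable setT (EFin \o (fun y => B (k, y) * q y)).
  apply: (@le_integrable _ _ _ mu _ measurableT _ (fun y => M%:E * (EFin \o q) y)%E).
  - apply/measurable_EFinP/measurable_funM => //; exact: measurable_fun_pair2.
  - by move=> y _; rewrite /= lee_fin !normrM ler_wpM2r // (le_trans (BM _)) // ler_norm.
  - exact: (@integrableZl _ _ _ mu _ measurableT M _ iq).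
have ipB y : mu.-integrable setT (EFin \o (fun k => p k * B (k, y))).
  apply: (@le_integrable _ _ _ mu _ measurableT _ (fun k => M%:E * (EFin \o p) k)%E).
  - apply/measurable_EFinP/measurable_funM => //; exact: measurable_fun_pair1.
  - by move=> k _; rewrite /= lee_fin !normrM mulrC ler_wpM2r // (le_trans (BM _)) // ler_norm.
  - exact: (@integrableZl _ _ _ mu _ measurableT M _ ip).
have EF k : (\int[mu]_y f (k, y) = (p k * \int[mu]_y (B (k, y) * q y))%:E)%E.
  rewrite /f /=; under eq_integral do rewrite EFinM.
  rewrite integralZl //; last exact: iBq.
  by rewrite EFinM /Rintegral fineK //; apply: integrable_fin_num => //; exact: iBq.
have EG y : (\int[mu]_k f (k, y) = (\int[mu]_k (p k * B (k, y)) * q y)%:E)%E.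
  rewrite /f /=; under eq_integral do rewrite mulrA mulrC EFinM.
  rewrite integralZl //; last exact: ipB.
  rewrite mulrC EFinM /Rintegral fineK //; apply: integrable_fin_num => //; exact: ipB.
have intf : (mu \x mu)%E.-integrable setT f.
  apply/(@integrable12ltyP _ _ _ _ _ mu mu f mf).
  have in1 : mu.-integrable setT (EFin \o (fun y => `|q y|)) by exact: integrable_norm.
  have ip1 : mu.-integrable setT (EFin \o (fun y => `|p y|)) by exact: integrable_norm.
  have inner k : (\int[mu]_y `|f (k, y)| <= (M * \int[mu]_y `|q y|)%:E * (`|p k|)%:E)%E.
    apply: (@le_trans _ _ (\int[mu]_y ((`|p k| * M)%:E * (`|q y|)%:E))%E).
      apply: ge0_le_integral => //.
      - by apply: measurableT_comp => //; exact: measurable_fun_pair2.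
      - apply: emeasurable_funM => //; exact: measurable_int in1.
      - by move=> y _; rewrite /f /= lee_fin !normrM mulrA ler_wpM2r // ler_wpM2l.
    rewrite (@integralZl _ _ _ mu _ measurableT _ in1).
    rewrite -(fineK (integrable_fin_num _ in1)) // -!EFinM lee_fin /Rintegral.
    by rewrite -mulrA mulrC.
  apply: (@le_lt_trans _ _ (\int[mu]_k ((M * \int[mu]_y `|q y|)%:E * (`|p k|)%:E))%E).
    apply: ge0_le_integral => //.
    - by move=> k _; exact: integral_ge0.
    - have mfa : measurable_fun setT (abse \o f) by exact: measurableT_comp.
      exact: (@measurable_fun_fubini_tonelli_F _ _ _ _ _ mu _ mfa (fun=> abse_ge0 _)).
    - apply: emeasurable_funM => //; exact: measurable_int ip1.
  rewrite (@integralZl _ _ _ mu _ measurableT _ ip1).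
  by rewrite -(fineK (integrable_fin_num _ ip1)) // -EFinM ltry.
split.
  apply: eq_integrable (integrable_fubini_F intf) => // k _.
  by rewrite /fubini_F EF.
have := Fubini intf.
under eq_integral do rewrite EF; under [in RHS]eq_integral do rewrite EG.
by rewrite /Rintegral => ->.
Qed.

Lemma fubini_halfline p q (B : R * R -> R) (M : R) : L1 p -> L1 q ->
  measurable_fun setT B -> (forall z : R * R, `|B z| <= M) ->
  L1 (fun k => p k * \int[mu]_(y in H) (B (k, y) * q y)) /\
  \int[mu]_(k in H) (p k * \int[mu]_(y in H) (B (k, y) * q y)) =
  \int[mu]_(y in H) ((\int[mu]_(k in H) (p k * B (k, y))) * q y).
Proof.
move=> /L1_setT ip /L1_setT iq mB BM.
have [iF eqF] := fubini_setT ip iq mB BM.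
have FE k : \int[mu]_y (B (k, y) * (q \_ H) y) = \int[mu]_(y in H) (B (k, y) * q y).
  rewrite [RHS]Rintegral_mkcond; apply: eq_Rintegral => y _.
  by rewrite !patchE; case: ifP; rewrite ?mulr0.
have GE y : \int[mu]_k ((p \_ H) k * B (k, y)) = \int[mu]_(k in H) (p k * B (k, y)).
  rewrite [RHS]Rintegral_mkcond; apply: eq_Rintegral => k _.
  by rewrite !patchE; case: ifP; rewrite ?mul0r.
have pFE : (fun k => (p \_ H) k * \int[mu]_y (B (k, y) * (q \_ H) y)) =
    (fun k => p k * \int[mu]_(y in H) (B (k, y) * q y)) \_ H.
  by apply/funext => k; rewrite FE !patchE; case: ifP; rewrite ?mul0r.
split; first by apply/L1_setT; rewrite -pFE.
rewrite Rintegral_mkcond -pFE eqF [RHS]Rintegral_mkcond.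
apply: eq_Rintegral => y _; rewrite GE.
by rewrite !patchE; case: ifP; rewrite ?mulr0.
Qed.

(** The absolute value bounds the integrand on the whole plane: [phi n] grows
exponentially at minus infinity. *)
Let phi_abs n (z : R * R) : R := phi n `|z.1 * z.2|.

Let measurable_phi_abs n : measurable_fun setT (phi_abs n).
Proof.
apply: (@measurableT_comp _ _ _ _ _ _ (phi n)).
  by apply: continuous_measurable_fun; exact: continuous_phi.
apply: (@measurableT_comp _ _ _ _ _ _ (fun x : R => `|x|)); first exact: normr_measurable.
by apply: measurable_funM; [exact: measurable_fst | exact: measurable_snd].
Qed.

Let phi_absE n k y : 0 < k -> 0 < y -> phi_abs n (k, y) = phi n (k * y).
Proof. by move=> k0 y0; rewrite /phi_abs ger0_norm ?mulr_ge0 // ltW. Qed.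

(** For [n = 0], the coefficients of [q] in the eigenfunctions y |-> Phi(ky) of
the fourth derivative with q(0) = q'(0) = 0. *)
Definition Phi_transform n q k := \int[mu]_(y in H) (phi n (k * y) * q y).

Lemma fubini_phi n p q : L1 p -> L1 q ->
  [/\ L1 (fun k => p k * Phi_transform n q k),
      L1 (fun y => (\int[mu]_(k in H) (p k * phi n (k * y))) * q y) &
      \int[mu]_(k in H) (p k * Phi_transform n q k) =
      \int[mu]_(y in H) ((\int[mu]_(k in H) (p k * phi n (k * y))) * q y)].
Proof.
move=> ip iq.
have phi3 (z : R * R) : `|phi_abs n z| <= 3 by exact: normr_phi.
have phi3s (z : R * R) : `|(phi_abs n \o @unstable.swap R R) z| <= 3 by exact: phi3.
have [iF eqF] := fubini_halfline ip iq (measurable_phi_abs n) phi3.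
have [iG _] := fubini_halfline iq ip 
  (measurableT_comp (measurable_phi_abs n) (@measurable_swap _ _ _ _)) phi3s.
have FE k : 0 < k -> \int[mu]_(y in H) (phi_abs n (k, y) * q y) = Phi_transform n q k.
  move=> k0; apply: eq_Rintegral => y; rewrite inE halflineE => y0.
  by rewrite phi_absE.
have GE y : 0 < y ->
    \int[mu]_(k in H) (p k * phi_abs n (k, y)) = \int[mu]_(k in H) (p k * phi n (k * y)).
  move=> y0; apply: eq_Rintegral => k; rewrite inE halflineE => k0.
  by rewrite phi_absE.
split.
- by apply: eq_integrable iF => // k; rewrite inE halflineE => k0; rewrite /= FE.
- apply: eq_integrable iG => // y; rewrite inE halflineE => y0.
  rewrite /= -GE // mulrC; congr (_ * _)%:E.
  by apply: eq_Rintegral => k _; rewrite mulrC.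
- transitivity (\int[mu]_(k in H) (p k * \int[mu]_(y in H) (phi_abs n (k, y) * q y))).
    by apply: eq_Rintegral => k; rewrite inE halflineE => k0; rewrite FE.
  rewrite eqF; apply: eq_Rintegral => y; rewrite inE halflineE => y0.
  by rewrite GE.
Qed.

(** * Schur's test with a Poisson majorant *)

(** The supremum half of Schur's test: the majorant has mass at most [C * pi] in y,
whatever x. *)
Lemma young_sup (G q : R -> R) s x (C S : R) : 0 < s -> 0 <= C -> 0 <= S ->
  (forall y, 0 < y -> `|G y| <= C * poisson s (x - y)) ->
  (forall y, 0 < y -> `|q y| <= S) -> L1 (fun y => G y * q y) ->
  `|\int[mu]_(y in H) (G y * q y)| <= C * S * pi.
Proof.
move=> s0 C0 S0 hG hq iGq.
apply: (le_trans (@le_normr_Rintegral _ _ _ mu _ _ measurable_halfline iGq)).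
apply: (@le_trans _ _ (\int[mu]_(y in H) (C * S * poisson s (x - y)))).
  apply: le_Rintegral => //; [exact: L1_norm | exact/L1Zl/L1_poisson |].
  move=> y; rewrite halflineE => y0; rewrite normrM mulrAC ler_pM ?normr_ge0 //.
    exact: hG.
  exact: hq.
rewrite RintegralZl //; last exact: L1_poisson.
rewrite ler_wpM2l ?mulr_ge0 // -lee_fin.
rewrite fineK; first exact: integral_poisson_le.
by apply: integrable_fin_num => //; exact: L1_poisson.
Qed.

(** Measurability is part of the conclusion because it is a consequence of the
same theorem, for the same function on the plane, as the bound. *)
Lemma tonelli_poisson q s : 0 < s -> measurable_fun H q ->
  measurable_fun H (fun x => \int[mu]_(y in H) (poisson s (x - y) * `|q y|)%:E)%E /\
  (\int[mu]_(x in H) \int[mu]_(y in H) (poisson s (x - y) * `|q y|)%:E <=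
   pi%:E * \int[mu]_(y in H) `|q y|%:E)%E.
Proof.
move=> s0 mq.
pose q' : R -> R := (fun y => `|q y|) \_ H.
have q'0 y : 0 <= q' y by rewrite /q' patchE; case: ifP.
have mq' : measurable_fun setT q'.
  apply/(@measurable_restrictT _ _ _ _ H _ measurable_halfline).
  exact: measurableT_comp mq.
pose f (z : R * R) : \bar R := (\1_H z.1 * (poisson s (z.1 - z.2) * q' z.2))%:E.
have f0 (z : R * R) : (0 <= f z)%E.
  rewrite lee_fin; apply: mulr_ge0; first by rewrite indicE ler0n.
  by apply: mulr_ge0; [exact: poisson_ge0 | exact: q'0].
have mf : measurable_fun setT f.
  apply/measurable_EFinP/measurable_funM.
    apply: (@measurableT_comp _ _ _ _ _ _ (\1_H : R -> R)); last exact: measurable_fst.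
    exact: measurable_indic.
  apply: measurable_funM; last exact: measurableT_comp mq' measurable_snd.
  apply: (@measurableT_comp _ _ _ _ _ _ (poisson s)).
    by apply: continuous_measurable_fun; exact: continuous_poisson.
  by apply: measurable_funB; [exact: measurable_fst | exact: measurable_snd].
have fE x : H x -> (\int[mu]_(y in H) (poisson s (x - y) * `|q y|)%:E = \int[mu]_y f (x, y))%E.
  move=> Hx; rewrite integral_mkcond; apply: eq_integral => y _.
  rewrite patchE /f /= indicE (mem_set Hx) mul1r /q' patchE.
  by case: ifP; rewrite ?mulr0.
split.
  have := @measurable_fun_fubini_tonelli_F _ _ _ _ _ mu f mf f0.
  move=> /(measurable_funS measurableT (@subsetT _ H)); apply: eq_measurable_fun.
  by move=> x; rewrite inE => Hx; rewrite fE.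
have -> : (\int[mu]_(x in H) \int[mu]_(y in H) (poisson s (x - y) * `|q y|)%:E =
    \int[mu]_x \int[mu]_y f (x, y))%E.
  rewrite integral_mkcond; apply: eq_integral => x _; rewrite patchE.
  case: ifPn => xH; first by rewrite fE //; exact: set_mem.
  rewrite (eq_integral (cst 0%E)) ?integral0 // => y _.
  by rewrite /f /= indicE (negbTE xH) mul0r.
rewrite (@fubini_tonelli _ _ _ _ _ mu mu f mf f0).
have -> : (\int[mu]_(y in H) `|q y|%:E = \int[mu]_y (q' y)%:E)%E.
  by rewrite integral_mkcond restrict_EFin.
rewrite -ge0_integralZl ?lee_fin ?pi_ge0 //.
- apply: ge0_le_integral => //.
  + by move=> y _; exact: integral_ge0.
  + exact: (@measurable_fun_fubini_tonelli_G _ _ _ _ _ mu f mf f0).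
  + by apply: emeasurable_funM => //; exact/measurable_EFinP.
  move=> y _.
  have -> : (\int[mu]_x f (x, y) = \int[mu]_(x in H) ((q' y)%:E * (poisson s (y - x))%:E))%E.
    rewrite [RHS]integral_mkcond; apply: eq_integral => x _.
    rewrite /f /= indicE patchE; case: ifP => _; last by rewrite mul0r.
    by rewrite mul1r -opprB poisson_sym -EFinM mulrC.
  rewrite ge0_integralZl ?lee_fin //.
  + by rewrite muleC lee_wpmul2r ?lee_fin // integral_poisson_le.
  + apply/measurable_EFinP; apply: continuous_measurable_halfline => x _.
    exact: continuous_poissonB.
  + by move=> x _; rewrite lee_fin poisson_ge0.
- exact/measurable_EFinP.
- by move=> y _; rewrite lee_fin.
Qed.

(** The L^1 half of Schur's test. The order of integration is exchanged for the
continuous majorant and not for [G], so that [G] need not be jointly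
measurable. *)
Lemma young_L1 (W q : R -> R) (G : R -> R -> R) s (C : R) : 0 < s -> 0 <= C ->
  (forall x y, 0 < x -> 0 < y -> `|G x y| <= C * poisson s (x - y)) ->
  (forall x, 0 < x -> L1 (fun y => G x y * q y)) ->
  (forall x, 0 < x -> `|W x| = `|\int[mu]_(y in H) (G x y * q y)|) ->
  measurable_fun H W -> L1 q ->
  (\int[mu]_(x in H) `|W x|%:E <= (C * pi)%:E * \int[mu]_(y in H) `|q y|%:E)%E.
Proof.
move=> s0 C0 hG iGq eW mW iq.
have mq : measurable_fun H q by apply/measurable_EFinP; exact: measurable_int iq.
have [mI le_pi] := tonelli_poisson s0 mq.
rewrite EFinM -muleA.
apply: (le_trans _ (lee_wpmul2l _ le_pi)); last by rewrite lee_fin.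
rewrite -ge0_integralZl ?lee_fin //; last first.
  by move=> x _; apply: integral_ge0 => y _; rewrite lee_fin mulr_ge0 ?poisson_ge0.
apply: ge0_le_integral => //.
- by apply/measurable_EFinP; exact: measurableT_comp.
- by apply: emeasurable_funM.
move=> x; rewrite halflineE => x0; rewrite eW //.
rewrite (@EFin_normr_Rintegral _ _ _ mu _ _ measurable_halfline (iGq x x0)).
have mGq := measurable_int _ (iGq x x0).
have mpq : measurable_fun H (fun y => (poisson s (x - y) * `|q y|)%:E).
  apply/measurable_EFinP/measurable_funM; last exact: measurableT_comp.
  by apply: continuous_measurable_halfline => y _; exact: continuous_poissonB.
apply: (le_trans (le_abse_integral mu measurable_halfline mGq)).
rewrite -ge0_integralZl ?lee_fin //; last first.
  by move=> y _; rewrite lee_fin mulr_ge0 ?poisson_ge0.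
apply: ge0_le_integral => //.
- exact: measurableT_comp.
- exact: emeasurable_funM.
- move=> y; rewrite halflineE => y0; rewrite /= lee_fin normrM mulrA ler_wpM2r //.
  exact: hG.
Qed.

(** * Differentiating the evolution *)

Definition spectral l tau x k := k ^+ l * gauss tau k * phi l (k * x).

(** Up to the factor [pi], the l-th derivative of S(t) f; see [derive1n_Sop]. *)
Definition evolution l tau f x : R :=
  \int[mu]_(k in H) (spectral l tau x k * Phi_transform 0 f k).

Lemma normr_phi_pos n k x : 0 < k -> 0 < x -> `|phi n (k * x)| <= 3.
Proof. by move=> k0 x0; rewrite normr_phi // mulr_ge0 // ltW. Qed.

Lemma L1_spectral l tau x : 0 < tau -> 0 < x -> L1 (spectral l tau x).
Proof.
move=> tau0 x0; apply: (@L1_monomial_gaussM l tau _ 3 tau0) => k k0.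
  exact: continuous_phi_scale.
exact: normr_phi_pos.
Qed.

Lemma normr_Phi_transform n q k : 0 < k -> L1 q ->
  `|Phi_transform n q k| <= 3 * \int[mu]_(y in H) `|q y|.
Proof.
move=> k0 iq.
have mq : measurable_fun H q by apply/measurable_EFinP; exact: measurable_int iq.
have mphi : measurable_fun H (fun y => phi n (k * y)).
  apply: continuous_measurable_halfline => y _.
  exact: is_derive_continuous (is_derive_phi_scale n k y).
have iT : L1 (fun y => phi n (k * y) * q y).
  apply: (L1_le _ _ (L1Zl 3 (L1_norm iq))); first exact: measurable_funM.
  by move=> y y0; rewrite normrM ler_wpM2r // normr_phi_pos.
apply: (le_trans (@le_normr_Rintegral _ _ _ mu _ _ measurable_halfline iT)).
rewrite -RintegralZl //; last exact: L1_norm.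
apply: le_Rintegral => //; [exact: L1_norm | exact/L1Zl/L1_norm |].
by move=> y; rewrite halflineE => y0; rewrite normrM ler_wpM2r // normr_phi_pos.
Qed.

Lemma is_derive_spectral l tau x k :
  is_derive x 1 (fun x => spectral l tau x k) (spectral l.+1 tau x k).
Proof.
have ? := is_derive_phi_scale l k x.
by apply: is_derive_eq; rewrite /spectral exprS -![_ *: _]/(_ * _); ring.
Qed.

(** Differentiation under the integral sign on ]0, x + 1[, where the derivative
of the integrand is at most a multiple of k^(l+1) e^(-k^4 t). *)
Lemma is_derive_evolution l tau f x : 0 < tau -> L1 f -> 0 < x ->
  is_derive x 1 (evolution l tau f) (evolution l.+1 tau f x).
Proof.
move=> tau0 fi x0.
have [N N0 hN] : exists2 N : R, 0 <= N & forall k, 0 < k -> `|Phi_transform 0 f k| <= N.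
  exists (3 * \int[mu]_(y in H) `|f y|); first by rewrite mulr_ge0 //; apply: Rintegral_ge0.
  by move=> k k0; exact: normr_Phi_transform.
pose g x k := spectral l tau x k * Phi_transform 0 f k.
pose G k := `|3 * N * (k ^+ l.+1 * gauss tau k)|.
have gint y : `]0, x + 1[%classic y -> mu.-integrable H (EFin \o g y).
  rewrite /= in_itv /= => /andP[y0 _].
  by have [] := fubini_phi 0 (L1_spectral l tau0 y0) fi.
have dg y k : is_derive y 1 (g ^~ k) (spectral l.+1 tau y k * Phi_transform 0 f k).
  have := is_derive_spectral l tau y k => ?.
  by apply: is_derive_eq; rewrite -![_ *: _]/(_ * _); ring.
have Gint : mu.-integrable H (EFin \o G) by exact/L1_norm/L1Zl/L1_monomial_gauss.
have p1E y k : partial1of2 g y k = spectral l.+1 tau y k * Phi_transform 0 f k.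
  by rewrite partial1of2E derive_val.
have Gub y k : `]0, x + 1[%classic y -> H k -> `|partial1of2 g y k| <= G k.
  rewrite /= in_itv /= halflineE => /andP[y0 _] k0.
  rewrite p1E /G /spectral !normrM [leRHS]mulrC -[leLHS]mulrA.
  rewrite ler_wpM2l ?mulr_ge0 // (ger0_norm N0) [`|3|]ger0_norm // ler_pM //.
    exact: normr_phi_pos.
  exact: hN.
have Ix : `]0, x + 1[%classic x by rewrite /= in_itv /= x0 ltrDl ltr01.
have gder y k : `]0, x + 1[%classic y -> H k -> derivable (g ^~ k) y 1.
  by move=> _ _; case: (dg y k).
have G0 k : 0 <= G k by exact: normr_ge0.
apply: DeriveDef.
  exact: (@derivable_under_integral R _ _ mu g H measurable_halfline x 0 (x + 1)
    Ix gint gder G G0 Gint Gub).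
rewrite -derive1E (@differentiation_under_integral R _ _ mu g H measurable_halfline x 0 (x + 1)
  Ix gint gder G G0 Gint Gub).
by apply: eq_Rintegral => k _; rewrite -p1E.
Qed.

Lemma near_halfline x : 0 < x -> \forall y \near x, 0 < y.
Proof.
move=> x0; have : nbhs x H.
  by apply: open_nbhs_nbhs; split; [exact: open_halfline | rewrite halflineE].
by apply: filterS => y; rewrite halflineE.
Qed.

Lemma SopE t tau f x : 0 < tau -> t = tau ^+ 4 -> 0 < x -> L1 f ->
  Sop t f x = pi^-1 * evolution 0 tau f x.
Proof.
move=> tau0 -> x0 fi.
have [_ iG e] := fubini_phi 0 (L1_spectral 0 tau0 x0) fi.
rewrite /evolution e -RintegralZl //.
apply: eq_Rintegral => y _; rewrite mulrA /K; congr (_ * _ * _).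
apply: eq_Rintegral => k _.
by rewrite /spectral expr0 mul1r /gauss exprMn [k ^+ 4 * _]mulrC.
Qed.

(** At order 0 this is Fubini's theorem ([SopE]); the induction uses that a
derivative at x > 0 depends only on the values near x. *)
Lemma derive1n_Sop t tau f l x : 0 < tau -> t = tau ^+ 4 -> 0 < x -> L1 f ->
  (Sop t f)^`(l)%classic x = pi^-1 * evolution l tau f x.
Proof.
move=> tau0 tE + fi; elim: l x => [|l IH] x x0; first by rewrite derive1n0 (SopE tau0 tE).
rewrite derive1nS derive1E.
have eqn : \forall y \near x, (Sop t f)^`(l)%classic y = pi^-1 * evolution l tau f y.
  by near=> y; apply: IH; near: y; exact: near_halfline.
rewrite (near_eq_derive _ eqn).
have := is_derive_evolution l tau0 fi x0 => ?.
by rewrite derive_val -![_ *: _]/(_ * _); ring.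
Unshelve. all: by end_near. Qed.

Lemma is_derive_derive1n_Sop t tau f l x : 0 < tau -> t = tau ^+ 4 -> 0 < x -> L1 f ->
  is_derive x 1 (Sop t f)^`(l)%classic ((Sop t f)^`(l.+1)%classic x).
Proof.
move=> tau0 tE x0 fi.
have eqn : \forall y \near x, pi^-1 * evolution l tau f y = (Sop t f)^`(l)%classic y.
  by near=> y; rewrite (derive1n_Sop _ tau0 tE) //; near: y; exact: near_halfline.
apply: near_eq_is_derive eqn _.
have := is_derive_evolution l tau0 fi x0 => ?.
rewrite (derive1n_Sop _ tau0 tE) //.
by apply: is_derive_eq; rewrite -![_ *: _]/(_ * _); ring.
Unshelve. all: by end_near. Qed.

(** * Moving the derivatives onto the datum *)

Lemma phi0 n : (n %% 4 < 2)%N -> phi n 0 = 0 :> R.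
Proof.
rewrite phi_modn; case: (n %% 4)%N => [|[|//]] _ /=; rewrite oppr0 expR0 cos0 sin0; ring.
Qed.

Lemma Phi_transform_by_parts j q q' k : 0 < k ->
  (forall y, 0 < y -> is_derive y 1 q (q' y)) ->
  (forall y, 0 < y -> {for y, continuous q'}) -> L1 q -> L1 q' ->
  phi j.+3 (k * y) * q y @[y --> 0^'+] --> 0 ->
  k * Phi_transform j q k = - Phi_transform j.+3 q' k.
Proof.
move=> k0 dq cq' iq iq' h0.
have dphi n y := is_derive_phi_scale n k y.
have cphi n y : {for y, continuous (fun y => phi n (k * y))} := is_derive_continuous (dphi n y).
have iphi n g : L1 g -> L1 (fun y => phi n (k * y) * g y).
  move=> ig; apply: (L1_le _ _ (L1Zl 3 (L1_norm ig))).
    apply: measurable_funM; first by apply: continuous_measurable_halfline.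
    by apply/measurable_EFinP; exact: measurable_int ig.
  by move=> y y0; rewrite normrM ler_wpM2r // normr_phi_pos.
pose h y := phi j.+3 (k * y) * q y.
pose h' y := k * (phi j (k * y) * q y) + phi j.+3 (k * y) * q' y.
have dh y : 0 < y -> is_derive y 1 h (h' y).
  move=> y0; have ? := dq y y0; have ? := dphi j.+3 y.
  by apply: is_derive_eq; rewrite /h' -![_ *: _]/(_ * _); ring.
have i1 := L1Zl k (iphi j _ iq); have i2 := iphi j.+3 _ iq'.
have := @integral_derive_halfline h h' 0 dh _ h0 (iphi _ _ iq) (L1D i1 i2).
rewrite integral_halflineD // RintegralZl // ?oppr0; last exact: iphi.
move=> e; apply/eqP; rewrite -addr_eq0 e // => y y0.
apply: cvgD; last by apply: cvgM; [exact: cphi | exact: cq'].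
apply: cvgM; first exact: cvg_cst.
by apply: cvgM; [exact: cphi | exact: is_derive_continuous (dq y y0)].
Qed.

(** One of the two factors tends to 0 and the other one is bounded. *)
Lemma boundary_vanishes n k q (M : R) : 0 < k ->
  (forall y, 0 < y -> `|q y| <= M) ->
  phi n 0 = 0 :> R \/ q y @[y --> 0^'+] --> (0 : R) ->
  phi n (k * y) * q y @[y --> 0^'+] --> 0.
Proof.
move=> k0 qM vanish; apply/norm_cvg0P.
have pos : \forall y \near (0 : R)^'+, 0 < y by exact: nbhs_right_gt.
case: vanish => [p0|q0].
  have cp : phi n (k * y) @[y --> 0^'+] --> 0.
    rewrite -[X in _ --> X]p0 -[X in phi n X](mulr0 k).
    apply: cvg_at_right_filter.
    exact: is_derive_continuous (is_derive_phi_scale n k 0).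
  have : M * `|phi n (k * y)| @[y --> 0^'+] --> M * `|(0 : R)|.
    by apply: cvgM; [exact: cvg_cst | exact: cvg_norm].
  rewrite normr0 mulr0; apply: squeeze_cvgr (cvg_cst 0).
  by apply: filterS pos => y y0; rewrite normr_ge0 normrM mulrC ler_wpM2r // qM.
have : 3 * `|q y| @[y --> 0^'+] --> 3 * `|(0 : R)|.
  by apply: cvgM; [exact: cvg_cst | exact: cvg_norm].
rewrite normr0 mulr0; apply: squeeze_cvgr (cvg_cst 0).
by apply: filterS pos => y y0; rewrite normr_ge0 normrM ler_wpM2r // normr_phi_pos.
Qed.

(** The boundary term of step l contains phi (3l+3) 0 and f^(l)(0). If l is 2 or 3
mod 4, then 3l+3 is 1 or 0 mod 4 and the first factor is 0; otherwise the
second one is 0 by hypothesis. *)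
Lemma Phi_transform_derive1n n f k : 0 < k -> CkWk1 n f ->
  (forall l, (l < n)%N -> (l %% 4 < 2)%N -> vanishes_at0 l f) ->
  k ^+ n * Phi_transform 0 f k = (- 1) ^+ n * Phi_transform (3 * n) (f^`(n)%classic) k.
Proof.
move=> k0 [[[df cf] bf] fi] vf.
suff step l : (l <= n)%N -> k ^+ l * Phi_transform 0 f k =
    (- 1) ^+ l * Phi_transform (3 * l) (f^`(l)%classic) k by exact: step.
elim: l => [|l IH] ln; first by rewrite !expr0 muln0.
have dl y : 0 < y -> is_derive y 1 (f^`(l)%classic) (f^`(l.+1)%classic y).
  move=> y0; rewrite derive1nS derive1E; exact/derivableP/df.
have [M hM] := bf l (ltnW ln).
have bdry : phi (3 * l).+3 (k * y) * f^`(l)%classic y @[y --> 0^'+] --> 0.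
  apply: (boundary_vanishes k0 hM).
  have [l4|l4] := ltnP (l %% 4) 2; first by right; exact: vf.
  left; apply: phi0; lia.
have e := Phi_transform_by_parts k0 dl (fun y => cf l.+1 y ln) (fi _ (ltnW ln)) (fi _ ln) bdry.
rewrite exprS -mulrA IH ?(ltnW ln) // mulrCA e mulrN -mulNr exprS mulN1r.
by rewrite mulnS addnC addn3.
Qed.

(** * The estimates *)

Lemma evolution_kernel n tau f x : 0 < tau -> 0 < x -> CkWk1 n f ->
  (forall l, (l < n)%N -> (l %% 4 < 2)%N -> vanishes_at0 l f) ->
  L1 (fun y => kernel n tau x y * f^`(n)%classic y) /\
  evolution n tau f x =
    (- 1) ^+ n * \int[mu]_(y in H) (kernel n tau x y * f^`(n)%classic y).
Proof.
move=> tau0 x0 hf vf; have fni : L1 (f^`(n)%classic) by case: hf => _; apply.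
have ip : L1 (fun k => gauss tau k * phi n (k * x)).
  have := @L1_monomial_gaussM 0 tau (fun k => phi n (k * x)) 3 tau0.
  under [X in _ -> _ -> L1 X]eq_fun do rewrite expr0 mul1r.
  by apply=> k k0; [exact: continuous_phi_scale | exact: normr_phi_pos].
have [iF iG e] := fubini_phi (3 * n) ip fni.
have kE y : \int[mu]_(k in H) (gauss tau k * phi n (k * x) * phi (3 * n) (k * y)) =
    kernel n tau x y.
  by apply: eq_Rintegral => k _; rewrite mulrA.
split.
  by apply: eq_integrable iG => // y _; rewrite /= kE.
transitivity (\int[mu]_(k in H) ((- 1) ^+ n *
    (gauss tau k * phi n (k * x) * Phi_transform (3 * n) (f^`(n)%classic) k))).
  apply: eq_Rintegral => k; rewrite inE halflineE => k0.
  have et := Phi_transform_derive1n k0 hf vf.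
  by rewrite /spectral mulrCA -et; ring.
rewrite RintegralZl //; congr (_ * _); rewrite e.
by apply: eq_Rintegral => y _; rewrite kE.
Qed.

Lemma le_normC f x : 0 < x -> (`|f x|%:E <= normC f)%E.
Proof. by move=> x0; apply: ereal_sup_ubound; exists x => //; rewrite halflineE. Qed.

Lemma normC_ge0 f : (0 <= normC f)%E.
Proof. by apply: (le_trans _ (@le_normC f 1 ltr01)); rewrite lee_fin. Qed.

Lemma normC_le_normCk n f : (normC f^`(n)%classic <= normCk n f)%E.
Proof.
rewrite /normCk big_ord_recr /= leeDr //; apply: sume_ge0 => l _; exact: normC_ge0.
Qed.

Lemma normL1_le_normWk1 n f : (normL1 f^`(n)%classic <= normWk1 n f)%E.
Proof.
rewrite /normWk1 big_ord_recr /= leeDr //; apply: sume_ge0 => l _.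
by apply: integral_ge0 => x _; rewrite lee_fin.
Qed.

(** One constant serves all orders n, because the kernel bound is uniform in n.
It is the constant of that bound: the factor 1 / pi of S(t) cancels the mass
[pi] of the Poisson majorant. *)
Lemma estimates_of_vanishing : exists2 C : R, 0 < C & forall n t f, 0 < t -> CkWk1 n f ->
  (forall l, (l < n)%N -> (l %% 4 < 2)%N -> vanishes_at0 l f) -> estimates C t n f.
Proof.
have [C C0 hC] := @normr_kernel_poisson; exists C => // n t f t0 hf vf.
pose tau := Num.sqrt (Num.sqrt t).
have tau0 : 0 < tau by rewrite !sqrtr_gt0.
have tE : t = tau ^+ 4.
  by rewrite (exprM tau 2 2) !sqr_sqrtr // ?sqrtr_ge0 // ltW.
have [[_ bf] fint] := hf; have f1 : L1 f by exact: (fint 0).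
have fn1 : L1 (f^`(n)%classic) by exact: (fint n).
pose W := (Sop t f)^`(n)%classic.
have dW l x : 0 < x -> is_derive x 1 ((Sop t f)^`(l)%classic) ((Sop t f)^`(l.+1)%classic x).
  by move=> x0; exact: (is_derive_derive1n_Sop _ tau0 tE).
have cW l x : 0 < x -> {for x, continuous (Sop t f)^`(l)%classic}.
  by move=> x0; exact: is_derive_continuous (dW l x x0).
have mW : measurable_fun H W by apply: continuous_measurable_halfline; exact: cW.
have iKf x : 0 < x -> L1 (fun y => kernel n tau x y * f^`(n)%classic y).
  by move=> x0; case: (evolution_kernel tau0 x0 hf vf).
have WE x : 0 < x ->
    `|W x| = pi^-1 * `|\int[mu]_(y in H) (kernel n tau x y * f^`(n)%classic y)|.
  move=> x0; rewrite /W (derive1n_Sop _ tau0 tE) //.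
  have [_ ->] := evolution_kernel tau0 x0 hf vf.
  by rewrite !normrM normrX normrN1 expr1n mul1r ger0_norm // invr_ge0 pi_ge0.
have pi0 : 0 < pi :> R by exact: pi_gt0.
have supW (S : R) : 0 <= S -> (forall y, 0 < y -> `|f^`(n)%classic y| <= S) ->
    forall x, 0 < x -> `|W x| <= C * S.
  move=> S0 hS x x0; rewrite WE // mulrC ler_pdivrMr //.
  by apply: (young_sup tau0 (ltW C0) S0 _ hS (iKf x x0)) => y y0; exact: hC.
have L1W : (\int[mu]_(x in H) `|W x|%:E <= C%:E * normL1 f^`(n)%classic)%E.
  have hC' x y : 0 < x -> 0 < y ->
      `|pi^-1 * kernel n tau x y| <= pi^-1 * C * poisson tau (x - y).
    move=> x0 y0; rewrite normrM ger0_norm ?invr_ge0 ?(ltW pi0) // -mulrA ler_wpM2l ?hC //.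
    by rewrite invr_ge0 // ltW.
  have := @young_L1 W (f^`(n)%classic) (fun x y => pi^-1 * kernel n tau x y) tau
    (pi^-1 * C) tau0.
  rewrite mulrAC mulVf ?gt_eqF // mul1r; apply=> //.
  - by rewrite mulr_ge0 ?invr_ge0 ?(ltW pi0) // ltW.
  - move=> x x0; have := L1Zl pi^-1 (iKf x x0).
    by under eq_fun do rewrite mulrA.
  - move=> x x0; rewrite WE //.
    under [in RHS]eq_Rintegral do rewrite -mulrA.
    rewrite RintegralZl //; last exact: iKf.
    by rewrite normrM [`|pi^-1|]ger0_norm // invr_ge0 ltW.
have [S0 hS0] := bf n (leqnn n).
have S00 : 0 <= S0 by apply: le_trans (hS0 1 ltr01).
split.
- by split=> [l x _ x0 | l x _ x0]; [case: (dW l x x0) | exact: cW].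
- split.
    split; first by split=> [//|l x]; rewrite leqn0 => /eqP -> x0; exact: cW.
    move=> l; rewrite leqn0 => /eqP ->; exists (C * S0); exact: supW.
  apply: (le_trans _ (lee_wpmul2l _ (normC_le_normCk n f))); last by rewrite lee_fin ltW.
  have fS : normC f^`(n)%classic \is a fin_num.
    rewrite ge0_fin_numE ?normC_ge0 //; apply: (@le_lt_trans _ _ S0%:E); last exact: ltry.
    by apply: ge_ereal_sup => _ [y + <-]; rewrite halflineE lee_fin => /hS0.
  rewrite -(fineK fS) -EFinM; apply: ge_ereal_sup => _ [x + <-]; rewrite halflineE => x0.
  rewrite lee_fin; apply: supW => //; first by rewrite fine_ge0 // normC_ge0.
  by move=> y y0; rewrite -lee_fin fineK // le_normC.
- split; last first.
    apply: (le_trans L1W); apply: lee_wpmul2l; first by rewrite lee_fin ltW.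
    exact: normL1_le_normWk1.
  apply/integrableP; split; first exact/measurable_EFinP.
  apply: (le_lt_trans L1W); apply: lte_mul_pinfty; rewrite ?lee_fin ?(ltW C0) //.
  have /integrableP[_] := fn1; exact.
Qed.

End HalfLineEvolution.

Theorem corollary4 (R : realType) (m : nat) :
  exists C : R, 0 < C /\
  forall t : R, 0 < t ->
  [/\ forall f : R -> R, CkWk1 (4 * m + 1) f -> condA m f ->
        estimates C t (4 * m + 1) f,
      forall f : R -> R, CkWk1 (4 * m + 2) f -> condA m f -> condB m f ->
        estimates C t (4 * m + 2) f,
      forall f : R -> R, CkWk1 (4 * m + 3) f -> condA m f -> condB m f ->
        estimates C t (4 * m + 3) f &
      forall f : R -> R, CkWk1 (4 * m + 4) f -> condA m f -> condB m f ->
        estimates C t (4 * m + 4) f].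
Proof.
have [C C0 hC] := @estimates_of_vanishing R; exists C; split=> // t t0.
have van (f : R -> R) l : condA m f -> (l < 4 * m + 1)%N -> (l %% 4 < 2)%N -> vanishes_at0 l f.
  move=> [A0 A1] lm l4.
  have [l0|l1] := ltnP (l %% 4) 1.
    have -> : l = (4 * (l %/ 4))%N by lia.
    by apply: A0; lia.
  have -> : l = (4 * (l %/ 4) + 1)%N by lia.
  by apply: A1; lia.
have vanB (f : R -> R) l : condA m f -> condB m f -> (l < 4 * m + 4)%N -> (l %% 4 < 2)%N ->
    vanishes_at0 l f.
  move=> A B lm l4; have [ll|ll] := ltnP l (4 * m + 1); first exact: van.
  have -> : l = (4 * m + 1)%N by lia.
  exact: B.
split=> f hf A => [|B|B|B]; apply: hC => // l ln l4; try exact: van.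
all: by apply: vanB => //; lia.
Qed.
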